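(* The (locally finite) group $\mathrm{Sym}_o(\mathbb{N})$ of all permutations of $\mathbb{N}$ with finite support is flabby, and thus the Left Strong Ergodic Theorem fails for this group.
   Context: A countable group $G$ is flabby if there exists a unitary representation $(\mathcal{H},\pi)$ of $G$ with no non-zero $\pi(G)$-invariant vectors with the property that for any sequence $(F_n)$ of finite subsets of $G$ whose sizes tend to infinity, there exists a sequence $(s_n)$ in $G$ such that $\lim_n\big\|\frac{1}{|F_n|}\sum_{s\in F_n}\pi(ss_n)v\big\|=1$ for some unit vector $v\in\mathcal{H}$. A sequence $(F_n)$ of (nonempty) finite subsets of $G$ is a left Følner sequence if $\lim_n|F_n\triangle tF_n|/|F_n|=0$ for all $t\in G$. The Left Strong Ergodic Theorem holds for a countable amenable group $G$ if for every unitary representation $(\mathcal{H},\pi)$ of $G$, every left Følner sequence $(F_n)$ in $G$ and every $v\in\mathcal{H}$, $\lim_n\frac{1}{|F_n|}\sum_{s\in F_n}\pi(s)v=P_Gv$ in norm, where $P_G$ is the orthogonal projection onto the closed subspace of $\pi(G)$-invariant vectors; otherwise it fails. The support of a permutation $s$ of $\mathbb{N}$ is $\{x\in\mathbb{N}: s(x)\neq x\}$. *)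

(* Defs.v *)
From HB Require Import structures.
From mathcomp Require Import all_boot all_order all_algebra finmap.
From mathcomp Require Import all_classical all_reals all_analysis.
From mathcomp Require Import complex.

Set Implicit Arguments.
Unset Strict Implicit.
Unset Printing Implicit Defensive.

Import Order.TTheory GRing.Theory Num.Theory.
Import numFieldNormedType.Exports.
Local Open Scope classical_set_scope.
Local Open Scope ring_scope.

(* Complex Hilbert spaces.  [hdot] is linear in its first argument and
   conjugate-linear in the second; the norm takes its values in R[i]. *)

HB.mixin Record NormedModule_isHilbert (R : realType) H
    of CompleteNormedModule R[i] H := {
  hdot : {dot H for @Num.conj R[i]} ;
  hdot_norm : forall v : H, `|v| ^+ 2 = hdot v v
}.

#[short(type="hilbertType")]
HB.structure Definition Hilbert (R : realType) :=
  {H of NormedModule_isHilbert R H & CompleteNormedModule R[i] H}.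

(* Meant for closed subspaces M, where the vector it picks exists and is
   unique by the projection theorem. *)
Definition orth_proj (R : realType) (H : hilbertType R) (M : set H) (v : H)
    : H :=
  xget 0 [set p | M p /\ forall w, M w -> hdot (v - p) w = 0].

Definition unitary (R : realType) (H : hilbertType R) (u : {linear H -> H}) :=
  bijective u /\ forall v w, hdot (u v) (u w) = hdot v w.

Definition unitary_rep (R : realType) (G : groupType) (H : hilbertType R)
    (pi : G -> {linear H -> H}) : Prop :=
  (forall s, unitary (pi s)) /\
  (forall s t v, pi (s * t)%g v = pi s (pi t v)).

Definition invariants (R : realType) (G : groupType) (H : hilbertType R)
    (pi : G -> {linear H -> H}) : set H :=
  [set v | forall s, pi s v = v].

(* The type ascription to R[i]^o equips R[i] with the topology given by its
   norm. *)
Definition flabby (R : realType) (G : groupType) : Prop :=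
  exists (H : hilbertType R) (pi : G -> {linear H -> H}),
    [/\ unitary_rep pi,
        invariants pi `<=` [set 0] &
        forall F : nat -> {fset G}, #|` F n|%fset @[n --> \oo] --> \oo ->
          exists (t : nat -> G) (v : H), `|v| = 1 /\
            `| (#|` F n|%fset%:R)^-1 *: \sum_(s <- F n) pi (s * t n)%g v |
              @[n --> \oo] --> (1 : R[i]^o)].

Definition left_folner (R : realType) (G : groupType) (F : nat -> {fset G})
    : Prop :=
  (forall n, F n != fset0) /\
  forall t : G,
    let tF n := [fset (t * s)%g | s in F n]%fset in
    #|` (F n `\` tF n) `|` (tF n `\` F n)|%fset%:R / #|` F n|%fset%:R
      @[n --> \oo] --> (0 : R).

(* Amenability of a countable group, in Folner's form. *)
Definition amenable (R : realType) (G : groupType) : Prop :=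
  exists F : nat -> {fset G}, left_folner R F.

Definition left_strong_ergodic (R : realType) (G : groupType) : Prop :=
  forall (H : hilbertType R) (pi : G -> {linear H -> H}), unitary_rep pi ->
  forall F : nat -> {fset G}, left_folner R F ->
  forall v : H,
    (#|` F n|%fset%:R)^-1 *: \sum_(s <- F n) pi s v
      @[n --> \oo] --> orth_proj (invariants pi) v.

Definition subgroup (G : groupType) (K : set G) : Prop :=
  [/\ K 1%g, forall s t, K s -> K t -> K (s * t)%g & forall s, K s -> K s^-1%g].

Definition locally_finite (G : groupType) : Prop :=
  forall A : set G, finite_set A -> finite_set (smallest (@subgroup G) A).

(* Finitely supported permutations of nat, multiplied by composition:
   (s * t) x = s (t x), the opposite of the convention of perm.v. *)

Definition perm_support (f : nat -> nat) : set nat := [set x | f x <> x].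

Definition fin_perm (f : nat -> nat) : bool :=
  `[< bijective f /\ finite_set (perm_support f) >].

Definition Sym_o : Type := {f : nat -> nat | fin_perm f}.

HB.instance Definition _ := SubType.on Sym_o.
HB.instance Definition _ := Choice.on Sym_o.

Lemma fin_perm_id : fin_perm id.
Proof.
apply/asboolP; split; first by exists id.
by rewrite (_ : perm_support id = set0) // -subset0 => x; apply.
Qed.

Lemma fin_perm_comp f g : fin_perm f -> fin_perm g -> fin_perm (f \o g).
Proof.
move=> /asboolP[bf ff] /asboolP[bg fg]; apply/asboolP; split.
  exact: bij_comp.
apply: (@sub_finite_set _ _ (perm_support f `|` perm_support g)).
  move=> x /= fgx; apply: contrapT => /not_orP[/contrapT fx /contrapT gx].
  by apply: fgx; rewrite /= gx.
by rewrite finite_setU.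
Qed.

Definition perm_inv (f : nat -> nat) (y : nat) : nat := xget 0%N (f @^-1` [set y]).

Lemma perm_invK f : bijective f -> cancel (perm_inv f) f.
Proof.
by move=> [g _ gK] y; apply: (@xgetPex _ 0%N (f @^-1` [set y])); exists (g y).
Qed.

Lemma permK f : bijective f -> cancel f (perm_inv f).
Proof. by move=> bf x; apply: (bij_inj bf); rewrite perm_invK. Qed.

Lemma fin_perm_inv f : fin_perm f -> fin_perm (perm_inv f).
Proof.
move=> /asboolP[bf ff]; apply/asboolP; split.
  by exists f; [exact: perm_invK | exact: permK].
apply: sub_finite_set ff => x /= ifx fx; apply: ifx.
by rewrite -{1}fx permK.
Qed.

Lemma Sym_oP (s : Sym_o) : bijective (val s).
Proof. by case/asboolP: (valP s). Qed.

Definition Sym_o1 : Sym_o := exist _ id fin_perm_id.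
Definition Sym_oM (s t : Sym_o) : Sym_o :=
  exist _ (val s \o val t) (fin_perm_comp (valP s) (valP t)).
Definition Sym_oV (s : Sym_o) : Sym_o :=
  exist _ (perm_inv (val s)) (fin_perm_inv (valP s)).

Lemma Sym_oMA : associative Sym_oM.
Proof. by move=> s t u; apply: val_inj. Qed.

Lemma Sym_o1M : left_id Sym_o1 Sym_oM.
Proof. by move=> s; apply: val_inj. Qed.

Lemma Sym_oM1 : right_id Sym_o1 Sym_oM.
Proof. by move=> s; apply: val_inj. Qed.

Lemma Sym_oVM : left_inverse Sym_o1 Sym_oV Sym_oM.
Proof.
by move=> s; apply: val_inj; apply: funext => x; apply: permK; apply: Sym_oP.
Qed.

Lemma Sym_oMV : right_inverse Sym_o1 Sym_oV Sym_oM.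
Proof.
by move=> s; apply: val_inj; apply: funext => x; apply: perm_invK; apply: Sym_oP.
Qed.

HB.instance Definition _ :=
  isGroup.Build Sym_o Sym_oMA Sym_o1M Sym_oM1 Sym_oVM Sym_oMV.

(* Main.v *)
(** Flabbiness is witnessed by the permutation representation of Sym_o on
    l^2(nat), (pi(s) f)(n) = f(s^-1 n).  An invariant vector is constant, hence
    zero.  Given finite sets F_n, pick a point x_n fixed by every element of
    F_n and let t_n be the transposition of 0 and x_n: then pi(s t_n) sends
    delta_0 to delta_{x_n} for all s in F_n, so the averages have norm exactly
    1.  If moreover (F_n) is left Folner (such as F_n = Sym(n)), so is
    (F_n t_n), and along it the averages of v cannot tend to the projection
    of v onto the invariants, which is 0. *)

From HB Require Import structures.
Require Import Defs.
From mathcomp Require Import all_boot all_order all_algebra finmap.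
From mathcomp Require Import all_classical all_reals all_analysis.
From mathcomp Require Import complex lra ring.
Set Implicit Arguments.
Unset Strict Implicit.
Unset Printing Implicit Defensive.
Import Order.TTheory GRing.Theory Num.Theory.
Import numFieldNormedType.Exports.
Local Open Scope classical_set_scope.
Local Open Scope ring_scope.

(** * Finitely supported permutations *)

(** The copy of the symmetric group on $\{0,\dots,n-1\}$: these finite subgroups increase with [n]
    and exhaust [Sym_o]. *)
Definition Sym (n : nat) : set Sym_o :=
  [set s | forall k, (n <= k)%N -> val s k = k].

Lemma Sym_le (m n : nat) : (m <= n)%N -> Sym m `<=` Sym n.
Proof. by move=> mn s sm k nk; apply: sm; apply: leq_trans nk. Qed.

(** If $n \le s(k)$, then $s$ fixes $s(k)$, and injectivity gives $s(k) = k$, so $n \le k$. *)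
Lemma Sym_lt (n : nat) (s : Sym_o) (k : nat) :
  Sym n s -> (k < n)%N -> (val s k < n)%N.
Proof.
move=> sn; apply: contraLR; rewrite -!leqNgt => nsk.
by rewrite -(bij_inj (Sym_oP s) (sn _ nsk)).
Qed.

Lemma Sym_subgroup (n : nat) : subgroup (Sym n).
Proof.
split=> [//|s t sn tn k nk|s sn k nk] /=; first by rewrite tn ?sn.
by rewrite -{1}(sn k nk) permK//; exact: Sym_oP.
Qed.

Lemma finite_bounded (A : set nat) :
  finite_set A -> exists n, forall k, A k -> (k < n)%N.
Proof.
move=> fA; exists (\max_(k <- fset_set A) k).+1 => k Ak.
by rewrite ltnS; apply: leq_bigmax_seq => //; rewrite in_fset_set// inE.
Qed.

Lemma Sym_exhaust (s : Sym_o) : exists n, Sym n s.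
Proof.
have /asboolP[_ /finite_bounded[n sn]] := valP s.
by exists n => k nk; apply: contrapT => /sn; rewrite ltnNge nk.
Qed.

Lemma finite_sub_Sym (A : set Sym_o) : finite_set A -> exists n, A `<=` Sym n.
Proof.
move=> fA; have [f fP] := choice Sym_exhaust.
have [n nP] := finite_bounded (finite_image f fA).
exists n => s As; apply: Sym_le (fP s); apply: ltnW; apply: nP.
by exists s.
Qed.

Lemma finite_Sym (n : nat) : finite_set (Sym n).
Proof.
(* An element of [Sym n] is determined by its restriction to ['I_n]; [g] recovers it from there,
   with the default [1] on maps that do not come from a permutation. *)
pose g (phi : {ffun 'I_n -> 'I_n}) : Sym_o :=
  xget 1%g [set s | Sym n s /\ forall i : 'I_n, val s i = phi i :> nat].
apply: (@sub_finite_set _ _ (g @` setT)); last exact/finite_image/finite_finset.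
move=> s sn; pose phi := [ffun i : 'I_n => Ordinal (Sym_lt sn (ltn_ord i))].
exists phi => //; rewrite /g.
case: xgetP => [t _ [tn tphi]|/(_ s)[]]; last first.
  by split=> // i; rewrite ffunE.
apply/val_inj/funext => k; have [nk|kn] := leqP n k; first by rewrite sn ?tn.
by have := tphi (Ordinal kn); rewrite ffunE.
Qed.

Lemma Sym_o_countable : countable [set: Sym_o].
Proof.
apply: (@sub_countable _ _ _ (\bigcup_n Sym n)).
  by apply: subset_card_le => s _; have [n sn] := Sym_exhaust s; exists n.
by apply: bigcup_countable => // n _; exact/finite_set_countable/finite_Sym.
Qed.

(** A finite set lies in some [Sym n], which is a finite subgroup and so contains the subgroup
    generated. *)
Lemma Sym_o_locally_finite : locally_finite Sym_o.
Proof.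
move=> A /finite_sub_Sym[n An]; apply: sub_finite_set (finite_Sym n).
by apply: smallest_sub => //; exact: Sym_subgroup.
Qed.

Section Swap.
Variables a b : nat.

Definition swap_fun (k : nat) := if k == a then b else if k == b then a else k.

Lemma swap_funK : involutive swap_fun.
Proof.
move=> k; rewrite /swap_fun; have [->|ka] := eqVneq k a.
  by rewrite eqxx; have [|_] := eqVneq b a; rewrite ?eqxx.
have [->|kb] := eqVneq k b; first by rewrite eqxx.
by rewrite (negPf ka) (negPf kb).
Qed.

Lemma fin_perm_swap : fin_perm swap_fun.
Proof.
apply/asboolP; split; first exact: inv_bij swap_funK.
apply: (@sub_finite_set _ _ [set a; b]); last exact: finite_set2.
move=> k /=; rewrite /perm_support /swap_fun /=.
by have [->|_] := eqVneq k a; [left | have [->|] := eqVneq k b; [right|]].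
Qed.

Definition swap : Sym_o := exist _ swap_fun fin_perm_swap.

End Swap.

Lemma swapL a b : val (swap a b) a = b.
Proof. by rewrite /= /swap_fun eqxx. Qed.

(** * The Følner sequence of finite symmetric groups *)

Definition folner_Sym (n : nat) : {fset Sym_o} := fset_set (Sym n).

Lemma in_folner_Sym n s : (s \in folner_Sym n) = (s \in Sym n).
Proof. by rewrite in_fset_set//; exact: finite_Sym. Qed.

(** The elements [swap 0 i] with [i < n] (the identity for [i = 0]) are told apart by their value at
    0. *)
Lemma card_folner_Sym (n : nat) : (n <= #|` folner_Sym n|)%N.
Proof.
have inj : injective (fun i : 'I_n => swap 0 i).
  by move=> i j /(congr1 (fun s => val s 0%N)); rewrite !swapL => /val_inj.
rewrite -[leqLHS]card_ord cardE -(size_map (fun i : 'I_n => swap 0 i)).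
apply: uniq_leq_size; first by rewrite map_inj_uniq ?enum_uniq.
move=> _ /mapP[i _ ->]; rewrite in_folner_Sym inE => k nk /=.
have ik := leq_trans (ltn_ord i) nk; rewrite /swap_fun.
by rewrite !gtn_eqF//; exact: leq_ltn_trans ik.
Qed.

Lemma folner_Sym_cvg : #|` folner_Sym n|%fset @[n --> \oo] --> \oo.
Proof.
move=> A [N _ NA]; exists N => // n /= Nn; apply: NA.
exact: leq_trans (card_folner_Sym n).
Qed.

(** If [t] lies in [Sym m], then for $n \ge m$ left translation by [t] maps the subgroup [Sym n]
    onto itself, so the Følner ratio is eventually exactly 0. *)
Lemma left_folner_Sym (R : realType) : left_folner R folner_Sym.
Proof.
split=> [n|t].
  by apply/fset0Pn; exists 1%g; rewrite in_folner_Sym inE.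
have [m tm] := Sym_exhaust t; apply: cvg_near_cst; exists m => // n /= mn.
have tn := Sym_le mn tm; have [_ SM SV] := Sym_subgroup n.
rewrite (_ : [fset (t * s)%g | s in folner_Sym n]%fset = folner_Sym n).
  by rewrite fsetDv fsetU0 cardfs0 mul0r.
apply/fsetP => s; apply/imfsetP/idP => /= [[u]|].
  by rewrite !in_folner_Sym !inE => un ->; exact: SM.
rewrite in_folner_Sym inE => sn; exists (t^-1 * s)%g; last first.
  by rewrite mulgA mulgV mul1g.
by rewrite in_folner_Sym inE; apply: SM => //; exact: SV.
Qed.

(** * The Hilbert space l^2 *)

Section ComplexSeries.
Variable R : realType.
Implicit Types (z : R[i]) (u v : nat -> R[i]).

(** Real and imaginary parts are treated separately, so that all limits of series are taken in
    [R]. *)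
Definition csummable u :=
  cvgn (series (fun n => complex.Re (u n))) /\
  cvgn (series (fun n => complex.Im (u n))).

Definition csum u : R[i] :=
  Complex (limn (series (fun n => complex.Re (u n))))
          (limn (series (fun n => complex.Im (u n)))).

Lemma csumD u v : csummable u -> csummable v ->
  csum (fun n => u n + v n) = csum u + csum v.
Proof.
move=> [Ru Iu] [Rv Iv]; rewrite /csum.
have -> : (fun n => complex.Re (u n + v n)) =
    (fun n => complex.Re (u n)) + (fun n => complex.Re (v n)).
  by apply/funext => n; rewrite !fctE; case: (u n) (v n) => a b [c d].
have -> : (fun n => complex.Im (u n + v n)) =
    (fun n => complex.Im (u n)) + (fun n => complex.Im (v n)).
  by apply/funext => n; rewrite !fctE; case: (u n) (v n) => a b [c d].
by rewrite !lim_seriesD.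
Qed.

Lemma csumZ z u : csummable u -> csum (fun n => z * u n) = z * csum u.
Proof.
move=> [Ru Iu]; rewrite /csum; case: z => a b.
have -> : (fun n => complex.Re (Complex a b * u n)) =
    a *: (fun n => complex.Re (u n)) - b *: (fun n => complex.Im (u n)).
  by apply/funext => n; rewrite !fctE; case: (u n).
have -> : (fun n => complex.Im (Complex a b * u n)) =
    a *: (fun n => complex.Im (u n)) + b *: (fun n => complex.Re (u n)).
  by apply/funext => n; rewrite !fctE; case: (u n).
have cZ k (w : nat -> R) : cvgn (series w) -> cvgn (series (k *: w)).
  exact: is_cvg_seriesZ.
rewrite lim_seriesB ?lim_seriesD; try exact: cZ.
by rewrite !lim_seriesZ.
Qed.

Lemma csum_conj u : csummable u -> csum (fun n => (u n)^*) = (csum u)^*.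
Proof.
move=> [Ru Iu]; rewrite /csum.
have -> : (fun n => complex.Re (u n)^*) = (fun n => complex.Re (u n)).
  by apply/funext => n; case: (u n).
have -> : (fun n => complex.Im (u n)^*) = - (fun n => complex.Im (u n)).
  by apply/funext => n; rewrite !fctE; case: (u n).
by rewrite lim_seriesN.
Qed.

End ComplexSeries.

(** Being an equality of filters, it rewrites under both [cvg] and [lim], with no convergence to be
    checked first. *)
Lemma near_eq_fmap (T U : Type) (F : set_system T) (FF : Filter F)
    (f g : T -> U) :
  {near F, f =1 g} -> f @ F = g @ F.
Proof.
move=> fg; rewrite eqEsubset; split; apply: near_eq_cvg => //.
by apply: filterS fg => x /= /esym.
Qed.

(** Once [n] is past the support, [s] permutes the indices below [n], so the partial sums agree
    exactly and no rearrangement theorem is involved. *)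
Lemma series_perm (V : zmodType) (u : nat -> V) (s : Sym_o) :
  \forall n \near \oo, series (u \o val s) n = series u n.
Proof.
have [N sN] := Sym_exhaust s.
exists N => // n /= Nn; rewrite /series /= -(big_map (val s) xpredT u).
apply: perm_big; have injs := bij_inj (Sym_oP s).
have us : uniq (map (val s) (index_iota 0 n)).
  by rewrite map_inj_uniq ?iota_uniq.
apply: uniq_perm; rewrite ?iota_uniq//.
(* The image of the indices below [n] has no repetition and the right size, so inclusion in these
   indices suffices. *)
apply: (uniq_min_size us _ _).2; last by rewrite size_map.
move=> _ /mapP[k /[!mem_index_iota]/= kn ->]; rewrite ltnNge; apply/negP => nsk.
by move: kn; rewrite ltnNge -(injs _ _ (sN _ (leq_trans Nn nsk))) nsk.
Qed.

Lemma csum_perm (R : realType) (u : nat -> R[i]) (s : Sym_o) :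
  csum (u \o val s) = csum u.
Proof.
by rewrite /csum; congr Complex; congr (lim _); apply: near_eq_fmap;
  apply: series_perm.
Qed.

Section SquareSummable.
Variable R : realType.
Implicit Types (f g : nat -> R[i]).

(** $|z|^2$ as an element of [R], whereas the library norm of [z] lives in [R[i]]. *)
Definition sqnorm (z : R[i]) : R := complex.Re z ^+ 2 + complex.Im z ^+ 2.

Lemma sqnorm_ge0 z : 0 <= sqnorm z.
Proof. by rewrite addr_ge0// sqr_ge0. Qed.

Lemma sqnormE z : z * z^* = Complex (sqnorm z) 0.
Proof. by rewrite -[RHS]/((sqnorm z)%:C)%C add_Re2_Im2 normCK. Qed.

Lemma sqnorm0 : sqnorm 0 = 0.
Proof. by rewrite /sqnorm/= expr0n addr0. Qed.

Lemma sqnorm_eq0 z : sqnorm z = 0 -> z = 0.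
Proof.
case: z => a b /eqP; rewrite /sqnorm paddr_eq0 ?sqr_ge0// !sqrf_eq0/=.
by case/andP => /eqP-> /eqP->.
Qed.

(** By the parallelogram law, the right side minus the left is $|z-w|^2$. *)
Lemma sqnormD z w : sqnorm (z + w) <= 2 * sqnorm z + 2 * sqnorm w.
Proof.
case: z w => a b [c d]; rewrite /sqnorm/= -subr_ge0.
rewrite (_ : _ - _ = (a - c) ^+ 2 + (b - d) ^+ 2); last by ring.
by rewrite addr_ge0// sqr_ge0.
Qed.

Lemma sqnormB z w : sqnorm (z - w) =
  (complex.Re z - complex.Re w) ^+ 2 + (complex.Im z - complex.Im w) ^+ 2.
Proof. by case: z w => a b [c d]. Qed.

Lemma sqnormM z w : sqnorm (z * w) = sqnorm z * sqnorm w.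
Proof. by case: z w => a b [c d]; rewrite /sqnorm/=; ring. Qed.

(** A crude bound, like the next one for the imaginary part; together they make the series defining
    the inner product converge. *)
Lemma Re_mulJ_le z w : `|complex.Re (z * w^*)| <= sqnorm z + sqnorm w.
Proof.
case: z w => a b [c d]; rewrite /sqnorm/= mulrN opprK ler_norml.
have := (sqr_ge0 (a - c), sqr_ge0 (a + c), sqr_ge0 (b - d), sqr_ge0 (b + d)).
by move=> [[[]]] ? ? ? ?; apply/andP; split; nra.
Qed.

Lemma Im_mulJ_le z w : `|complex.Im (z * w^*)| <= sqnorm z + sqnorm w.
Proof.
case: z w => a b [c d]; rewrite /sqnorm/= mulrN ler_norml.
have := (sqr_ge0 (a - d), sqr_ge0 (a + d), sqr_ge0 (b - c), sqr_ge0 (b + c)).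
by move=> [[[]]] ? ? ? ?; apply/andP; split; nra.
Qed.

Definition sqsummable f := `[< cvgn (series (fun n => sqnorm (f n))) >].

Lemma series_dominated (u v : nat -> R) :
  (forall n, `|u n| <= v n) -> cvgn (series v) -> cvgn (series u).
Proof.
move=> uv cv; apply: normed_cvg; apply: series_le_cvg cv => n //=.
exact: le_trans (uv n).
Qed.

(** The partial sums are nondecreasing, so one bound yields both convergence and a bound on the
    sum. *)
Lemma sqsummableP f M : (forall n, series (fun k => sqnorm (f k)) n <= M) ->
  sqsummable f /\ limn (series (fun k => sqnorm (f k))) <= M.
Proof.
move=> fM; have cf : cvgn (series (fun k => sqnorm (f k))).
  apply: nondecreasing_is_cvgn.
    by apply: nondecreasing_series => k _ _; exact: sqnorm_ge0.
  by exists M => _ [n _ <-].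
by split; [exact/asboolP | apply: limr_le => //; exact: nearW].
Qed.

Lemma sqsummable_submod : submod_closed sqsummable.
Proof.
split=> [|a f g /asboolP cf /asboolP cg]; apply/asboolP.
  have -> : series (fun n => sqnorm ((0 : nat -> R[i]) n)) = cst 0.
    by apply/funext => n; rewrite /series/= big1// => k _; exact: sqnorm0.
  exact: is_cvg_cst.
apply: (@series_dominated _
  ((2 * sqnorm a) *: (fun n => sqnorm (f n)) + 2 *: (fun n => sqnorm (g n)))).
  move=> n; rewrite ger0_norm ?sqnorm_ge0// !fctE.
  by rewrite (le_trans (sqnormD _ _))// sqnormM mulrA.
by apply: is_cvg_seriesD; exact: is_cvg_seriesZ.
Qed.

HB.instance Definition _ :=
  GRing.isSubmodClosed.Build R[i] (nat -> R[i]) sqsummable sqsummable_submod.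

Definition l2 : Type := {f : nat -> R[i] | sqsummable f}.
HB.instance Definition _ := SubType.on l2.
HB.instance Definition _ := Choice.on l2.
HB.instance Definition _ := [SubChoice_isSubLmodule of l2 by <:].

End SquareSummable.

(** * Cauchy-Schwarz and the triangle inequality for a dot product *)

Section DotTriangle.
Variables (C : numClosedFieldType) (U : lmodType C).
Variable form : {dot U for @Num.conj C}.
Local Notation "''[' u , v ]" := (form u%R v%R) : ring_scope.
Local Notation "''[' u ]" := '[u, u]%R : ring_scope.

Lemma dot_CauchySchwarz u v : `|'[u, v]| ^+ 2 <= '[u] * '[v].
Proof.
have [->|v0] := eqVneq v 0; first by rewrite !linear0r normr0 expr0n.
have vv : '[v] != 0 by rewrite dnorm_eq0.
(* [w] is the component of [u] orthogonal to [v]; Pythagoras for [u = w + a *: v] then gives the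
   bound. *)
pose a := '[u, v] / '[v]; pose w := u - a *: v.
have wv : '[w, v] = 0 by rewrite /w linearBl/= linearZl_LR/= divfK// subrr.
rewrite (_ : u = w + a *: v); last by rewrite /w subrK.
rewrite linearDl/= wv add0r linearZl_LR/= normrM (ger0_norm (dnorm_ge0 _ _)).
rewrite hnormDd/=; last by rewrite linearZr_LR/= wv mulr0.
by rewrite exprMn dnormZ mulrDl expr2 !mulrA lerDr mulr_ge0.
Qed.

Lemma dot_triangle u v : sqrtC '[u + v] <= sqrtC '[u] + sqrtC '[v].
Proof.
rewrite -ler_sqr ?nnegrE ?addr_ge0 ?sqrtC_ge0 ?dnorm_ge0//.
rewrite dnormD sqrrD !sqrtCK [leRHS]addrAC lerD2l -mulr_natr.
(* The cross terms add up to twice the real part of ['[u, v]]. After halving, the real part is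
   bounded by the modulus and the modulus by Cauchy-Schwarz. *)
rewrite -[leLHS](divfK (negbT (pnatr_eq0 C 2))) ler_pM2r ?ltr0n// -ReE.
apply: (le_trans (leif_Re_Creal _)).
rewrite -ler_sqr ?nnegrE ?mulr_ge0 ?sqrtC_ge0 ?dnorm_ge0//.
by rewrite exprMn !sqrtCK dot_CauchySchwarz.
Qed.

End DotTriangle.

(** * Inner product, norm and completeness of $\ell^2$ *)

Section L2Hilbert.
Variable R : realType.
Local Notation H := (l2 R).
Implicit Types f g h : H.

Lemma csummable_mulJ f g : csummable (fun n => val f n * (val g n)^*).
Proof.
have /asboolP cf := valP f; have /asboolP cg := valP g.
have cfg := is_cvg_seriesD cf cg.
split; apply: series_dominated cfg => n.
  exact: Re_mulJ_le.
exact: Im_mulJ_le.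
Qed.

Definition l2dot f g := csum (fun n => val f n * (val g n)^*).

Lemma l2dotC f g : l2dot f g = (l2dot g f)^*.
Proof.
rewrite /l2dot -csum_conj; last exact: csummable_mulJ.
by congr csum; apply/funext => n; rewrite rmorphM/= conjCK mulrC.
Qed.

Lemma l2dot_linearl g : GRing.linear_for *%R (l2dot^~ g).
Proof.
move=> a f h; rewrite /l2dot -csumZ; last exact: csummable_mulJ.
transitivity (csum (fun n => val (a *: f) n * (val g n)^* +
                             val h n * (val g n)^*)).
  by congr csum; apply/funext => n; rewrite -mulrDl.
rewrite csumD; [|exact: csummable_mulJ|exact: csummable_mulJ].
by congr (csum _ + _); apply/funext => n; rewrite mulrA.
Qed.

Lemma l2dot_linearr f : GRing.linear_for (@Num.conj R[i] \; *%R) (l2dot f).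
Proof.
by move=> a g h; rewrite l2dotC l2dot_linearl rmorphD rmorphM/= -!l2dotC.
Qed.

HB.instance Definition _ := @bilinear_isBilinear.Build R[i] H H R[i]
  *%R (@Num.conj R[i] \; *%R) l2dot (l2dot_linearl, l2dot_linearr).

Lemma l2dot_herm f g : l2dot f g = (-1) ^+ false * (l2dot g f)^*.
Proof. by rewrite expr0 mul1r l2dotC. Qed.

HB.instance Definition _ := @isHermitianSesquilinear.Build R[i] H false
  (@Num.conj R[i]) l2dot l2dot_herm.

Definition l2sq f : R := limn (series (fun n => sqnorm (val f n))).

Lemma l2dotE f : l2dot f f = Complex (l2sq f) 0.
Proof.
rewrite /l2dot (_ : (fun n => _) = fun n => Complex (sqnorm (val f n)) 0).
  congr Complex; rewrite (_ : series _ = cst 0) ?lim_cst//.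
  by apply/funext => n; rewrite /series/= big1.
by apply/funext => n; rewrite sqnormE.
Qed.

Lemma series_sqnorm_le f n :
  series (fun n => sqnorm (val f n)) n <= l2sq f.
Proof.
apply: nondecreasing_cvgn_le; last by move: (valP f) => /asboolP.
by apply: nondecreasing_series => k _ _; exact: sqnorm_ge0.
Qed.

Lemma sqnorm_coord_le f n :
  sqnorm (val f n) <= l2sq f.
Proof.
apply: le_trans (series_sqnorm_le f n.+1).
by rewrite seriesSr /= lerDr sumr_ge0// => k _; exact: sqnorm_ge0.
Qed.

Lemma l2dot_gt0 f : f != 0 -> 0 < l2dot f f.
Proof.
move=> f0; rewrite lt_def l2dotE; apply/andP; split; last first.
  by rewrite lecE/= eqxx (le_trans _ (sqnorm_coord_le f 0%N))// sqnorm_ge0.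
apply: contra f0 => /eqP[ff]; apply/eqP/val_inj/funext => n.
apply/sqnorm_eq0/eqP; rewrite eq_le sqnorm_ge0 andbT -ff.
exact: sqnorm_coord_le.
Qed.

HB.instance Definition _ := @isDotProduct.Build R[i] H l2dot l2dot_gt0.

Definition l2norm f : R[i] := sqrtC (l2dot f f).

Lemma l2normD f g : l2norm (f + g) <= l2norm f + l2norm g.
Proof. exact: dot_triangle. Qed.

Lemma l2normZ a f : l2norm (a *: f) = `|a| * l2norm f.
Proof.
rewrite /l2norm dnormZ sqrtCM ?nnegrE ?exprn_ge0 ?dnorm_ge0//.
by rewrite sqrCK.
Qed.

Lemma l2norm_eq0 f : l2norm f = 0 -> f = 0.
Proof. by move=> /eqP; rewrite sqrt_dnorm_eq0 => /eqP. Qed.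

HB.instance Definition _ :=
  @Lmodule_isNormed.Build R[i] H l2norm l2normD l2normZ l2norm_eq0.

(** Turns norm bounds in [R[i]] into bounds on the real number [l2sq f], to which limits of real
    series apply. *)
Lemma l2norm_le f (e : R) : 0 <= e -> (`|f| <= e%:C%C) = (l2sq f <= e ^+ 2).
Proof.
move=> e0; rewrite (_ : `|f| = sqrtC (l2dot f f))//.
rewrite -ler_sqr ?nnegrE ?sqrtC_ge0 ?dnorm_ge0 ?ler0c// sqrtCK l2dotE.
by rewrite -rmorphXn -[Complex _ _]/((l2sq f)%:C%C) lecR.
Qed.

Lemma l2_cauchyP (F : set_system H) (e : R) : ProperFilter F -> cauchy F ->
  0 < e -> exists2 A, F A & forall f g, A f -> A g -> l2sq (f - g) <= e ^+ 2.
Proof.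
move=> FF /cauchy_ballP/(_ e%:C%C) cF e0.
have /cF : (0 : R[i]) < e%:C%C by rewrite ltcR.
case=> -[A B]/= [FA FB] AB; exists (A `&` B); first exact: filterI.
move=> f g [Af _] [_ Bg]; rewrite -l2norm_le; last exact: ltW.
by have := AB (f, g) (conj Af Bg); rewrite /= -ball_normE/= => /ltW.
Qed.

(** Meant for [p] the real or the imaginary part: being additive and dominated by the modulus, it
    carries a Cauchy filter to a Cauchy filter on [R]. *)
Lemma l2_coord_cvg (F : set_system H) (p : R[i] -> R) (n : nat) :
  (forall z w, p (z - w) = p z - p w) -> (forall z, p z ^+ 2 <= sqnorm z) ->
  ProperFilter F -> cauchy F -> cvg (p (val f n) @[f --> F]).
Proof.
move=> pB pN FF cF; apply: cauchy_cvg; apply: cauchy_exP => e e0.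
(* Halving makes up for the weak inequality from [l2_cauchyP], since balls are defined by a strict
   one. *)
have e20 : 0 < e / 2 by rewrite divr_gt0.
have [A FA AN] := l2_cauchyP FF cF e20.
have [f Af] := filter_ex FA.
exists (p (val f n)); rewrite /fmap/=; apply: filterS FA => g Ag /=.
rewrite -ball_normE /= -pB.
have : p (val (f - g : H) n) ^+ 2 <= (e / 2) ^+ 2.
  by rewrite (le_trans (pN _))// (le_trans (sqnorm_coord_le _ _))// AN.
rewrite -[leLHS]real_normK ?num_real// ler_sqr ?nnegrE ?(ltW e20)//.
move=> /le_lt_trans.
by apply; rewrite ltr_pdivrMr// ltr_pMr// ltr1n.
Qed.

Lemma l2_complete (F : set_system H) : ProperFilter F -> cauchy F -> cvg F.
Proof.
move=> FF cF.
have cR n : cvg (complex.Re (val f n) @[f --> F]).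
  apply: l2_coord_cvg => // [[? ?] [? ?]//|z].
  by rewrite lerDl sqr_ge0.
have cI n : cvg (complex.Im (val f n) @[f --> F]).
  apply: l2_coord_cvg => // [[? ?] [? ?]//|z].
  by rewrite lerDr sqr_ge0.
pose G n := Complex (lim (complex.Re (val f n) @[f --> F]))
                    (lim (complex.Im (val f n) @[f --> F])).
(* A partial sum involves finitely many coordinates, so its bound by [e] survives the coordinatewise
   limit in [g], uniformly in [n]. *)
have GP f A e : F A -> A f -> (forall f g, A f -> A g -> l2sq (f - g) <= e) ->
    forall n, series (fun k => sqnorm (val f k - G k)) n <= e.
  move=> FA Af Ae n.
  have cs : series (fun k => sqnorm (val f k - val g k)) n @[g --> F] -->
            series (fun k => sqnorm (val f k - G k)) n.
    rewrite /series/=; apply: cvg_big => [|k _]; first exact: add_continuous.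
    under eq_fun do rewrite sqnormB.
    rewrite sqnormB; apply: cvgD; rewrite !expr2; apply: cvgM; apply: cvgB;
      [exact: cvg_cst | exact: cR | exact: cvg_cst | exact: cR
      |exact: cvg_cst | exact: cI | exact: cvg_cst | exact: cI].
  rewrite -(cvg_lim _ cs)//; apply: limr_le; first exact: cvgP cs.
  apply: filterS FA => g Ag.
  exact: le_trans (series_sqnorm_le (f - g) n) (Ae _ _ Af Ag).
have l2G : sqsummable G.
  have [A FA Ae] := l2_cauchyP FF cF (@ltr01 R).
  have [f Af] := filter_ex FA.
  have [fG _] := sqsummableP (GP f A _ FA Af Ae).
  (* [G] is the difference of [f] and [f - G], both square-summable. *)
  rewrite (_ : G = val f - (fun n => val f n - G n)); last first.
    by apply/funext => n; rewrite !fctE opprB addrC subrK.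
  exact: (rpredB (valP f : val f \in @sqsummable R) fG).
apply/cvg_ex; exists (Sub G l2G : H); apply/cvgrPdist_le => e.
(* Positivity in [R[i]] forces a zero imaginary part, so [e] comes from a positive real. *)
rewrite ltcE /= => /andP[/eqP e0 Re0].
have -> : e = (complex.Re e)%:C%C by case: e {Re0} e0 => a b /= ->.
have [A FA Ae] := l2_cauchyP FF cF Re0.
apply: (filterS _ FA) => f Af; rewrite distrC l2norm_le; last exact: ltW.
by have [] := sqsummableP (GP f A _ FA Af Ae).
Qed.

HB.instance Definition _ := Uniform_isComplete.Build H l2_complete.

Lemma l2norm_dot f : `|f| ^+ 2 = l2dot f f.
Proof. exact: sqrtCK. Qed.

HB.instance Definition _ :=
  @NormedModule_isHilbert.Build R H l2dot l2norm_dot.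

End L2Hilbert.

(** * The permutation representation *)

Section PermutationRepresentation.
Variable R : realType.
Local Notation H := (l2 R).
Implicit Types (f g : H) (s t : Sym_o).

Lemma sqsummable_perm (f : nat -> R[i]) s :
  sqsummable f -> sqsummable (f \o val s).
Proof.
move=> /asboolP cf; apply/asboolP.
by rewrite (near_eq_fmap _ (series_perm (fun n => sqnorm (f n)) s)).
Qed.

Definition perm_rep s f : H :=
  exist _ (val f \o val s^-1%g) (sqsummable_perm _ (valP f)).

Lemma perm_rep_linear s : linear (perm_rep s).
Proof. by move=> a f g; apply/val_inj/funext. Qed.

HB.instance Definition _ s := GRing.isLinear.Build R[i] H H *:%R (perm_rep s)
  (perm_rep_linear s).

Lemma perm_repM s t f : perm_rep (s * t)%g f = perm_rep s (perm_rep t f).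
Proof.
apply/val_inj/funext => n.
rewrite [LHS]/(val f (val (s * t)^-1%g n)).
by rewrite invgM.
Qed.

Lemma perm_rep_unitary : unitary_rep (perm_rep : Sym_o -> {linear H -> H}).
Proof.
have rep1 f : perm_rep 1%g f = f.
  apply/val_inj/funext => n.
  by rewrite [LHS]/(val f (val (1^-1%g : Sym_o) n)) invg1.
split=> [s|s t f]; last exact: perm_repM.
(* The action permutes the coordinate products by the finitely supported $s^{-1}$, which leaves
   their sum unchanged. *)
split=> [|f g]; last exact: (csum_perm (fun n => val f n * (val g n)^*)).
by exists (perm_rep s^-1%g) => f /=; rewrite -perm_repM ?mulVg ?mulgV rep1.
Qed.

Lemma perm_rep_invariants :
  invariants (perm_rep : Sym_o -> {linear H -> H}) `<=` [set 0].
Proof.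
move=> f fi; have f0 n : val f n = val f 0%N.
  rewrite -[in LHS](fi (swap 0 n)) /=; congr (val f _).
  by rewrite -[RHS](permK (Sym_oP (swap 0 n))) swapL.
(* The terms $|f(n)|^2$ of a convergent series tend to 0, but here they all equal $|f(0)|^2$. *)
have /asboolP/cvg_series_cvg_0 := valP f.
under eq_fun do rewrite f0.
move=> /(cvg_lim (@Rhausdorff R)); rewrite lim_cst//.
by move=> /sqnorm_eq0 f00; apply/val_inj/funext => n; rewrite f0 f00.
Qed.

Lemma series_sqnorm_delta (k n : nat) :
  series (fun i => sqnorm (i == k)%:R : R) n = (k < n)%:R.
Proof.
rewrite /series /= (eq_bigr (fun i => if i == k then 1 : R else 0)); last first.
  by move=> i _; case: eqP => _; rewrite /sqnorm/= ?expr1n expr0n addr0.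
by rewrite -big_mkcond/= big_nat1_eq/=; case: ifP.
Qed.

Lemma sqsummable_delta (k : nat) : sqsummable (fun i => (i == k)%:R : R[i]).
Proof.
apply: (sqsummableP (M := 1) _).1 => n.
by rewrite series_sqnorm_delta; case: (k < n)%N.
Qed.

Definition delta (k : nat) : H :=
  exist _ (fun i => (i == k)%:R) (sqsummable_delta k).

Lemma norm_delta (k : nat) : `|delta k| = 1.
Proof.
rewrite (_ : `|_| = sqrtC (l2dot (delta k) (delta k)))// l2dotE /l2sq.
suff -> : limn (series (fun i => sqnorm (val (delta k) i))) = 1 :> R.
  exact: sqrtC1.
apply: lim_near_cst => //.
by exists k.+1 => // n /= kn; rewrite series_sqnorm_delta kn.
Qed.

Lemma perm_rep_delta s (k : nat) : perm_rep s (delta k) = delta (val s k).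
Proof.
apply/val_inj/funext => n /=; congr (_%:R); congr (nat_of_bool _).
by apply/eqP/eqP => [<-|->]; rewrite ?perm_invK ?permK//; exact: Sym_oP.
Qed.

Lemma Sym_o_flabby : flabby R Sym_o.
Proof.
exists H, (perm_rep : Sym_o -> {linear H -> H}); split.
- exact: perm_rep_unitary.
- exact: perm_rep_invariants.
move=> F Foo.
have fixF n : exists k, forall s, s \in F n -> val s k = k.
  (* If [F n] is contained in [Sym k], the point [k] itself is fixed by all of [F n]. *)
  have [k Fk] := finite_sub_Sym (finite_fset (F n)).
  by exists k => s /Fk; exact.
have [k kP] := choice fixF.
exists (fun n => swap 0 (k n)), (delta 0); split; first exact: norm_delta.
apply: cvg_near_cst.
(* For nonempty [F n] the average is exactly [delta (k n)]; growth of the sizes makes this hold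
   eventually. *)
have : \forall n \near \oo, (0 < #|` F n|)%N.
  exact: (Foo _ (nbhs_infty_gt 0)).
apply: filterS => n Fn.
rewrite big_seq (eq_bigr (fun=> delta (k n))); last first.
  move=> s sF; rewrite [LHS]perm_rep_delta.
  by rewrite [LHS]/(delta (val s (val (swap 0 (k n)) 0%N))) swapL kP.
rewrite -big_seq big_const_seq count_predT iter_addr_0.
rewrite -[delta _ *+ _]scaler_nat scalerA mulVf ?pnatr_eq0 -?lt0n//.
by rewrite scale1r norm_delta.
Qed.

End PermutationRepresentation.

(** * Right translates of Følner sequences and failure of the ergodic theorem *)

(** The value of [xget] either lies in [M], hence is 0, or is the default, also 0. *)
Lemma orth_proj0 (R : realType) (H : hilbertType R) (M : set H) (v : H) :
  M `<=` [set 0] -> orth_proj M v = 0.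
Proof. by move=> M0; rewrite /orth_proj; case: xgetP => [p _ [/M0]|]. Qed.

Section RightTranslate.
Variables (G : groupType) (R : realType) (F : nat -> {fset G}) (t : nat -> G).

Definition right_translate (n : nat) : {fset G} :=
  [fset (s * t n)%g | s in F n]%fset.

(** Right multiplication by [t n] is injective and commutes with left translations, so the Følner
    ratios of the two sequences coincide. *)
Lemma left_folner_right_translate :
  left_folner R F -> left_folner R right_translate.
Proof.
have inj n : injective (fun s => (s * t n)%g) by exact: mulIg.
have imD n (A B : {fset G}) :
    ([fset (s * t n)%g | s in A] `\` [fset (s * t n)%g | s in B] =
    [fset (s * t n)%g | s in A `\` B])%fset.
  apply/fsetP => x; rewrite !inE.
  apply/andP/imfsetP => /= [[xB /imfsetP[/= s sA xs]]|[s]].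
    exists s => //; rewrite inE sA andbT; apply: contra xB => sB.
    by rewrite xs; apply/imfsetP; exists s.
  rewrite inE => /andP[sB sA] ->; split; last by apply/imfsetP; exists s.
  by apply: contra sB => /imfsetP[/= u uB /inj->].
move=> [F0 FF]; split=> [n|r].
  have /fset0Pn[s sF] := F0 n; apply/fset0Pn; exists (s * t n)%g.
  by apply/imfsetP; exists s.
have rt n : ([fset (r * s)%g | s in right_translate n] =
    [fset (s * t n)%g | s in [fset (r * s)%g | s in F n]])%fset.
  by rewrite -!imfset_comp; apply: eq_imfset => // s; rewrite /= mulgA.
apply: cvg_trans (FF r); apply: near_eq_cvg; apply: nearW => n.
by rewrite rt !imD -imfsetU !(card_imfset _ _ (inj n)).
Qed.

End RightTranslate.

Lemma flabby_not_left_strong_ergodic (R : realType) (G : groupType)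
    (F : nat -> {fset G}) :
  left_folner R F -> #|` F n|%fset @[n --> \oo] --> \oo ->
  flabby R G -> ~ left_strong_ergodic R G.
Proof.
move=> folF Foo [H [pi [upi inv0 /(_ F Foo)[t [v [_ v1]]]]]] lse.
have := lse H pi upi _ (left_folner_right_translate t folF) v.
rewrite orth_proj0// => /cvg_norm; rewrite normr0.
(* Reindexing by $s \mapsto s t_n$ identifies averages over the translated sets with those in the
   definition of flabbiness. *)
have avg n : (#|` right_translate F t n|%:R)^-1 *:
      \sum_(s <- right_translate F t n) pi s v =
    (#|` F n|%:R)^-1 *: \sum_(s <- F n) pi (s * t n)%g v.
  have inj : injective (fun s => (s * t n)%g) by exact: mulIg.
  by rewrite (card_imfset _ _ inj) big_imfset//= => s u _ _; exact: inj.
under eq_fun do rewrite avg.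
(* The norms of these averages would tend both to 0 and to 1. *)
move=> v0; have e01 := cvg_unique (@norm_hausdorff R[i] R[i]^o) v0 v1.
by have := oner_neq0 R[i]; rewrite -e01 eqxx.
Qed.

Theorem corollary1p4 (R : realType) :
  [/\ countable [set: Sym_o],
      locally_finite Sym_o,
      amenable R Sym_o,
      flabby R Sym_o &
      ~ left_strong_ergodic R Sym_o].
Proof.
split.
- exact: Sym_o_countable.
- exact: Sym_o_locally_finite.
- by exists folner_Sym; exact: left_folner_Sym.
- exact: Sym_o_flabby.
- exact: flabby_not_left_strong_ergodic (left_folner_Sym R) folner_Sym_cvg
    (Sym_o_flabby R).
Qed.
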